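(* Let $G$ be a task graph and $\beta\in(0,1)$, and let $\mathrm{OPT}$ be the infimum of all rewards for which a motivating cost configuration on $G$ exists. The algorithm MinMaxPathApprox, which runs in polynomial time, returns a cost configuration that is motivating for the reward $2\,\mathrm{OPT}$; i.e. it approximates MCC-OPT within a factor of $2$.
   Context: A task graph is a finite directed acyclic graph $G=(V,E)$ with start node $s$, target node $t$, and non-negative edge costs $c(e)$; every node lies on some path from $s$ to $t$. An agent with present bias $\beta$: $d(w)$ is the cost of a cheapest path from $w$ to $t$; the perceived cost of edge $(v,w)$ is $\eta(v,w)=c(v,w)+\beta d(w)$ and $\zeta(v)=\min\{\eta(v,w)\mid(v,w)\in E\}$. At $v\ne t$ she traverses only edges with $\eta(v,w)=\zeta(v)$ (ties arbitrary), and given reward $r$ at $t$ she continues iff $\zeta(v)\le\beta r$. The graph is motivating for $r$ if on every possible walk she never abandons before $t$. A cost configuration is $\tilde c:E\to\mathbb{R}_{\ge0}$, replacing $c(e)$ by $c(e)+\tilde c(e)$; it is motivating for $r$ if the modified graph is. MCC-OPT: given $G$ and $\beta\in(0,1)$, determine the infimum of all rewards for which a motivating cost configuration exists. Algorithm MinMaxPathApprox: let $\eta_0$ denote perceived costs with no extra cost. Compute a minmax path $P$ from $s$ to $t$ w.r.t. $\eta_0$ (a path minimizing the maximum $\eta_0$-value of its edges) and let $\varrho$ be that maximum. For each $v\ne t$ choose a successor $\varsigma(v)$ such that $(v,\varsigma(v))$ is the first edge of a cheapest path from $v$ to $t$ (w.r.t. $c$); the $\varsigma$-path of $v$ is $v,\varsigma(v),\varsigma(\varsigma(v)),\ldots,t$.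 For each edge $(v,w)$: if $(v,w)\in P$, or ($w=\varsigma(v)$ and $v\notin P$), set $\tilde c(v,w)=0$; else if $(v,w)\notin P$ and $w\ne\varsigma(v)$, set $\tilde c(v,w)=3\varrho/\beta$; otherwise ($v\in P$, $w=\varsigma(v)$, $(v,w)\notin P$) let $P'$ be the $\varsigma$-path of $v$, let $u$ be the first node of $P'$ after $v$ that lies on $P$, let $e$ be a most expensive edge (w.r.t. $c$) of $P'$ between $v$ and $u$, and set $\tilde c(v,w)=c(e)$. Return $\tilde c$. *)

(* Defs.v *)
(* MathComp / MathComp-Analysis *)
From HB Require Import structures.
From mathcomp Require Import all_boot all_order all_algebra.
From mathcomp Require Import boolp classical_sets reals.

Set Implicit Arguments.
Unset Strict Implicit.
Unset Printing Implicit Defensive.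
Import Order.TTheory GRing.Theory Num.Theory.
Local Open Scope classical_set_scope.
Local Open Scope ring_scope.

(** * Task graphs *)

Record graph (R : realType) (V : finType) := Graph {
  edge : rel V;
  source : V;
  target : V;
  cost : V -> V -> R  (* only the values on edges are meaningful *)
}.

(* [p] lists the nodes after [x], so that the walk is [x :: p]. *)
Definition path_to_target (R : realType) (V : finType) (G : graph R V)
    (x : V) (p : seq V) : bool :=
  path (edge G) x p && (last x p == target G).

Definition path_edges (V : finType) (x : V) (p : seq V) : seq (V * V) :=
  zip (x :: p) p.

Definition path_cost (R : realType) (V : finType) (G : graph R V)
    (x : V) (p : seq V) : R :=
  \sum_(e <- path_edges x p) cost G e.1 e.2.

Record task_graph (R : realType) (V : finType) (G : graph R V) : Prop :=
  TaskGraph {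
    task_graph_acyclic : forall p : seq V, cycle (edge G) p -> p = [::];
    task_graph_connected : forall v : V, exists p : seq V,
      path_to_target G (source G) p /\ v \in source G :: p;
    task_graph_cost_ge0 : forall v w : V, edge G v w -> 0 <= cost G v w
  }.

(** * The present-biased agent *)

(* The two infima below are minima in a task graph (the second one at every
   [v != target G]); on an empty set [inf] is the junk value 0. *)
Definition dist (R : realType) (V : finType) (G : graph R V) (w : V) : R :=
  inf [set x : R | exists2 p : seq V,
         path_to_target G w p & x = path_cost G w p].

Definition eta (R : realType) (V : finType) (G : graph R V) (beta : R)
    (v w : V) : R :=
  cost G v w + beta * dist G w.

Definition zeta (R : realType) (V : finType) (G : graph R V) (beta : R)
    (v : V) : R :=
  inf [set x : R | exists2 w : V, edge G v w & x = eta G beta v w].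

Definition agent_step (R : realType) (V : finType) (G : graph R V)
    (beta r : R) : rel V := fun v w =>
  [&& v != target G, zeta G beta v <= beta * r, edge G v w
    & eta G beta v w == zeta G beta v].

Definition motivating (R : realType) (V : finType) (G : graph R V)
    (beta r : R) : Prop :=
  forall p : seq V, path (agent_step G beta r) (source G) p ->
    last (source G) p != target G ->
    zeta G beta (last (source G) p) <= beta * r.

(** * Cost configurations *)

Definition cost_configuration (R : realType) (V : finType) (G : graph R V)
    (ct : V -> V -> R) : Prop :=
  forall v w : V, edge G v w -> 0 <= ct v w.

Definition add_cost (R : realType) (V : finType) (G : graph R V)
    (ct : V -> V -> R) : graph R V :=
  Graph (edge G) (source G) (target G) (fun v w => cost G v w + ct v w).

(* The sign condition on [r] only matters when [source G = target G], where the
   agent never has anything to decide; otherwise [zeta] is nonnegative at the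
   source and it is implied by [motivating]. *)
Definition opt (R : realType) (V : finType) (G : graph R V) (beta : R) : R :=
  inf [set r : R | 0 <= r /\ exists2 ct : V -> V -> R,
         cost_configuration G ct & motivating (add_cost G ct) beta r].

(** * MinMaxPathApprox *)

(* Perceived costs are nonnegative in a task graph; for the empty path (which
   is the case [source G = target G]) the maximum is 0. *)
Definition max_eta (R : realType) (V : finType) (G : graph R V) (beta : R)
    (x : V) (p : seq V) : R :=
  \big[Num.max/0]_(e <- path_edges x p) eta G beta e.1 e.2.

Definition minmax_path (R : realType) (V : finType) (G : graph R V) (beta : R)
    (p : seq V) : Prop :=
  path_to_target G (source G) p /\
  forall q : seq V, path_to_target G (source G) q ->
    max_eta G beta (source G) p <= max_eta G beta (source G) q.

Definition cheapest_path (R : realType) (V : finType) (G : graph R V)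
    (x : V) (p : seq V) : Prop :=
  path_to_target G x p /\
  forall q : seq V, path_to_target G x q -> path_cost G x p <= path_cost G x q.

(* The value of a successor function at the target is irrelevant. *)
Definition cheapest_successor (R : realType) (V : finType) (G : graph R V)
    (succ : V -> V) : Prop :=
  forall v : V, v != target G ->
    exists q : seq V, cheapest_path G v (succ v :: q).

Definition successor_path (R : realType) (V : finType) (G : graph R V)
    (succ : V -> V) (v : V) (q : seq V) : Prop :=
  [/\ fpath succ v q, last v q = target G & target G \notin belast v q].

Definition most_expensive_edge (R : realType) (V : finType) (G : graph R V)
    (x : V) (p : seq V) (e : V * V) : Prop :=
  e \in path_edges x p /\
  forall e' : V * V, e' \in path_edges x p ->
    cost G e'.1 e'.2 <= cost G e.1 e.2.

(* [a] is the extra cost of the edge [(v, succ v)] where the successor path of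
   [v], which is [v :: rcons q1 u ++ q2], leaves [P] at [v] and first meets
   [P] again at [u]. *)
Definition detour_cost (R : realType) (V : finType) (G : graph R V)
    (P : seq V) (succ : V -> V) (v : V) (a : R) : Prop :=
  exists (q1 : seq V) (u : V) (q2 : seq V) (e : V * V),
    [/\ successor_path G succ v (rcons q1 u ++ q2),
        forall z : V, z \in q1 -> z \notin P,
        u \in P,
        most_expensive_edge G v (rcons q1 u) e
      & a = cost G e.1 e.2].

(* [ct] is a possible output of the algorithm: the minmax path, the successors
   and the most expensive edges may be chosen arbitrarily. *)
Definition minmax_path_approx (R : realType) (V : finType) (G : graph R V)
    (beta : R) (ct : V -> V -> R) : Prop :=
  exists (p : seq V) (succ : V -> V),
    [/\ minmax_path G beta p, cheapest_successor G succ
      & let P := source G :: p in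
        let PE := path_edges (source G) p in
        let rho := max_eta G beta (source G) p in
        forall v w : V, edge G v w ->
        [/\ (v, w) \in PE \/ (w = succ v /\ v \notin P) -> ct v w = 0,
            (v, w) \notin PE -> w != succ v -> ct v w = 3 * rho / beta
          & v \in P -> w = succ v -> (v, w) \notin PE ->
              detour_cost G P succ v (ct v w)]].

(** * Polynomial time

    A program is a fixed piece of syntax, independent of the graph on which it
    is run.  It works on node registers, node-indexed tables of nodes and
    tables of numbers indexed by pairs of nodes (all of them named by natural
    numbers), and its only loops are "for each node".  Such programs always
    terminate, so that [exec] can be a function that also counts elementary
    steps: every node of the syntax tree of an expression or test, every
    assignment, every branching and every loop iteration costs one.

    The arithmetic is that of a random access machine over the reals at unit
    cost, but restricted to addition and to multiplication or division by the
    input [beta].  Hence no value can grow by iterated multiplication: on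
    rational inputs, all numbers occurring in the first [T] steps have
    numerators and denominators of bit length polynomial in [T] and in the bit
    length of the input, and a polynomial number of steps is polynomial time in
    the bit model as well. *)

Inductive node_expr :=
| NSource
| NTarget
| NReg of nat
| NTab of nat & node_expr.

Inductive num_expr :=
| RZero
| ROne
| RCost of node_expr & node_expr
| RTab of nat & node_expr & node_expr
| RAdd of num_expr & num_expr
| RMulBeta of num_expr
| RDivBeta of num_expr.

Inductive test :=
| TEdge of node_expr & node_expr
| TEq of node_expr & node_expr
| TLe of num_expr & num_expr
| TNot of test
| TAnd of test & test.

Inductive program :=
| PSkip
| PSetReg of nat & node_expr
| PSetNode of nat & node_expr & node_expr
| PSetNum of nat & node_expr & node_expr & num_expr
| PSeq of program & program
| PIf of test & program & program
| PForEach of nat & program.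

Fixpoint node_steps (e : node_expr) : nat :=
  match e with
  | NSource | NTarget | NReg _ => 1
  | NTab _ e1 => (node_steps e1).+1
  end.

Fixpoint num_steps (a : num_expr) : nat :=
  match a with
  | RZero | ROne => 1
  | RCost e1 e2 | RTab _ e1 e2 => (node_steps e1 + node_steps e2)%N.+1
  | RAdd a1 a2 => (num_steps a1 + num_steps a2)%N.+1
  | RMulBeta a1 | RDivBeta a1 => (num_steps a1).+1
  end.

Fixpoint test_steps (b : test) : nat :=
  match b with
  | TEdge e1 e2 | TEq e1 e2 => (node_steps e1 + node_steps e2)%N.+1
  | TLe a1 a2 => (num_steps a1 + num_steps a2)%N.+1
  | TNot b1 => (test_steps b1).+1
  | TAnd b1 b2 => (test_steps b1 + test_steps b2)%N.+1
  end.

Record state (R : realType) (V : finType) := State {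
  reg : nat -> V;
  node_table : nat -> V -> V;
  num_table : nat -> V -> V -> R
}.

Definition init_state (R : realType) (V : finType) (G : graph R V) :
    state R V :=
  State (fun _ => source G) (fun _ _ => source G) (fun _ _ _ => 0).

Definition set_reg (R : realType) (V : finType) (st : state R V)
    (k : nat) (v : V) : state R V :=
  State [eta reg st with k |-> v] (node_table st) (num_table st).

Definition set_node (R : realType) (V : finType) (st : state R V)
    (k : nat) (x v : V) : state R V :=
  State (reg st)
    (fun l y => if (l == k) && (y == x) then v else node_table st l y)
    (num_table st).

Definition set_num (R : realType) (V : finType) (st : state R V)
    (k : nat) (x y : V) (a : R) : state R V :=
  State (reg st) (node_table st)
    (fun l x' y' => if [&& l == k, x' == x & y' == y] then a
                    else num_table st l x' y').

Fixpoint eval_node (R : realType) (V : finType) (G : graph R V)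
    (st : state R V) (e : node_expr) : V :=
  match e with
  | NSource => source G
  | NTarget => target G
  | NReg k => reg st k
  | NTab k e1 => node_table st k (eval_node G st e1)
  end.

Fixpoint eval_num (R : realType) (V : finType) (G : graph R V) (beta : R)
    (st : state R V) (a : num_expr) : R :=
  match a with
  | RZero => 0
  | ROne => 1
  | RCost e1 e2 =>
      let v := eval_node G st e1 in let w := eval_node G st e2 in
      if edge G v w then cost G v w else 0
  | RTab k e1 e2 => num_table st k (eval_node G st e1) (eval_node G st e2)
  | RAdd a1 a2 => eval_num G beta st a1 + eval_num G beta st a2
  | RMulBeta a1 => beta * eval_num G beta st a1
  | RDivBeta a1 => eval_num G beta st a1 / beta
  end.

Fixpoint eval_test (R : realType) (V : finType) (G : graph R V) (beta : R)
    (st : state R V) (b : test) : bool :=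
  match b with
  | TEdge e1 e2 => edge G (eval_node G st e1) (eval_node G st e2)
  | TEq e1 e2 => eval_node G st e1 == eval_node G st e2
  | TLe a1 a2 => eval_num G beta st a1 <= eval_num G beta st a2
  | TNot b1 => ~~ eval_test G beta st b1
  | TAnd b1 b2 => eval_test G beta st b1 && eval_test G beta st b2
  end.

Fixpoint exec (R : realType) (V : finType) (G : graph R V) (beta : R)
    (c : program) (st : state R V) : state R V * nat :=
  match c with
  | PSkip => (st, 1%N)
  | PSetReg k e => (set_reg st k (eval_node G st e), (node_steps e).+1)
  | PSetNode k e1 e2 =>
      (set_node st k (eval_node G st e1) (eval_node G st e2),
       (node_steps e1 + node_steps e2)%N.+1)
  | PSetNum k e1 e2 a =>
      (set_num st k (eval_node G st e1) (eval_node G st e2)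
         (eval_num G beta st a),
       (node_steps e1 + node_steps e2 + num_steps a)%N.+1)
  | PSeq c1 c2 =>
      let: (st1, n1) := exec G beta c1 st in
      let: (st2, n2) := exec G beta c2 st1 in
      (st2, (n1 + n2)%N)
  | PIf b c1 c2 =>
      let: (st1, n1) := exec G beta (if eval_test G beta st b then c1 else c2) st in
      (st1, (test_steps b + n1)%N.+1)
  | PForEach k c1 =>
      foldl (fun (acc : state R V * nat) (v : V) =>
               let: (st1, n1) := exec G beta c1 (set_reg acc.1 k v) in
               (st1, (acc.2 + n1)%N.+1))
            (st, 1%N) (enum V)
  end.

(* The output of a program is its final number table of index 0.  The size of
   the input is measured by the number of nodes (it has at most #|V| ^ 2
   edges). *)
Definition polynomial_time (R : realType)
    (spec : forall V : finType, graph R V -> R -> (V -> V -> R) -> Prop) :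
    Prop :=
  exists (c : program) (q : {poly nat}),
  forall (V : finType) (G : graph R V) (beta : R),
    task_graph G -> 0 < beta < 1 ->
    let: (st, n) := exec G beta c (init_state G) in
    spec V G beta (num_table st 0) /\ (n <= q.[#|V|])%N.

(* Main.v *)
(* Let [rho] be the minmax perceived cost.  Extra costs only increase perceived
   costs, and the walk of a motivated agent is a path from [s] to [t], so
   [rho <= beta * OPT].  Under the computed configuration the extra costs met on
   a cheapest path belong to disjoint detours, each of which costs at least as
   much, so distances at most double, and at a node of the minmax path [P] the
   agent perceives at most [2 rho].  Only edges of [P] and cheapest-path edges
   are affordable; when she accepts a detour, the extra cost of its first edge is
   part of the perceived cost, and it bounds every edge of the detour, so she
   never perceives more than [2 rho] before she is back on [P].

   The polynomial bound on the running time holds for every program, since loops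
   run over the nodes only.  Distances, minmax values and detour costs all satisfy
   recursions along the edges of an acyclic graph, so each is computed by [#|V|]
   rounds in which every node is recomputed from its successors. *)

Require Import Defs.
From mathcomp Require Import all_boot all_order all_algebra.
From mathcomp Require Import boolp classical_sets reals.
From mathcomp Require Import lra.
Import Order.TTheory GRing.Theory Num.Theory.
Local Open Scope ring_scope.

Set Implicit Arguments.
Unset Strict Implicit.
Unset Printing Implicit Defensive.

(** * Task graphs *)

Section TaskGraphs.
Variables (R : realType) (V : finType) (G : graph R V).
Hypothesis tg : task_graph G.

Let s := source G.
Let t := target G.

(** A rank on the acyclic graph: it drops strictly along edges, which justifies induction on nodes
    and later bounds the rounds of the dynamic programs. *)
Definition reach (v : V) : nat := #|connect (edge G) v|.

Lemma reach_edge v w : edge G v w -> (reach w < reach v)%N.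
Proof.
move=> evw; apply: proper_card; apply/properP; split.
  by apply/fintype.subsetP=> u; apply: connect_trans; apply: connect1.
exists v; first exact: connect0.
(* A path from [w] back to [v] would close a cycle with the edge [(v, w)]. *)
apply/negP=> /connectP[p ewp vE].
have /(_ (w :: p)) := task_graph_acyclic tg.
by rewrite /= rcons_path ewp -vE evw => /(_ isT).
Qed.

Lemma reach_path v w q : path (edge G) v (w :: q) ->
  (reach (last w q) < reach v)%N.
Proof.
elim: q v w => [|u q IHq] v w /= /andP[evw]; first by move=> _; apply: reach_edge.
by move=> /IHq/ltn_trans; apply; apply: reach_edge.
Qed.

Lemma reach_gt0 v : (0 < reach v)%N.
Proof. by apply/card_gt0P; exists v; apply: connect0. Qed.

Lemma edge_ind (P : V -> Prop) :
  (forall v, (forall w, edge G v w -> P w) -> P v) -> forall v, P v.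
Proof.
move=> IH v; have [n] := ubnP (reach v); elim: n v => // n IHn v le_v_n.
by apply: IH => w /reach_edge lt_wv; apply: IHn; apply: leq_trans lt_wv _.
Qed.

Lemma edge_irrefl v : edge G v v = false.
Proof. by apply/negP=> /reach_edge; rewrite ltnn. Qed.

Lemma exists_path_to_target v : exists q, path_to_target G v q.
Proof.
have [p [/andP[esp /eqP tE]]] := task_graph_connected tg v.
rewrite inE => /predU1P[->|vp]; first by exists p; rewrite /path_to_target esp tE /=.
case/splitPr: vp esp tE => p1 p2; rewrite cat_path last_cat /= => /and3P[_ _ ep2] tE.
by exists p2; rewrite /path_to_target ep2 tE eqxx.
Qed.

(** Every node reaches the target, so an edge leaving it could be continued to a cycle. *)
Lemma target_sink w : edge G t w = false.
Proof.
apply/negP=> etw; have [q /andP[ewq /eqP tE]] := exists_path_to_target w.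
have /reach_path : path (edge G) t (w :: q) by rewrite /= etw.
by rewrite tE ltnn.
Qed.

Lemma edge_source_neq v w : edge G v w -> v != t.
Proof. by apply: contraTneq => ->; rewrite target_sink. Qed.

Lemma exists_edge v : v != t -> exists w, edge G v w.
Proof.
have [[|w q] /andP[/= evq /eqP tE]] := exists_path_to_target v.
  by rewrite tE eqxx.
by case/andP: evq => evw _; exists w.
Qed.

Lemma path_cost_cons v w q :
  path_cost G v (w :: q) = cost G v w + path_cost G w q.
Proof. by rewrite /path_cost /path_edges /= big_cons. Qed.

Lemma path_cost_nil v : path_cost G v [::] = 0.
Proof. by rewrite /path_cost /path_edges big_nil. Qed.

Lemma path_cost_ge0 v q : path (edge G) v q -> 0 <= path_cost G v q.
Proof.
elim: q v => [|w q IHq] v; first by rewrite path_cost_nil.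
by rewrite path_cost_cons /= => /andP[/(task_graph_cost_ge0 tg) ? /IHq]; apply: addr_ge0.
Qed.

Lemma path_edgesP v q e : path (edge G) v q -> e \in path_edges v q ->
  edge G e.1 e.2 /\ cost G e.1 e.2 <= path_cost G v q.
Proof.
elim: q v => [|w q IHq] v //; rewrite path_cost_cons /= => /andP[evw ewq].
rewrite inE => /predU1P[-> /=|/(IHq _ ewq)[ee le_e]]; split=> //.
  by rewrite lerDl path_cost_ge0.
by rewrite (le_trans le_e) // lerDr (task_graph_cost_ge0 tg).
Qed.

Lemma dist_le v q : path_to_target G v q -> dist G v <= path_cost G v q.
Proof.
move=> vq; apply: ge_inf; last by exists q.
by exists 0 => _ [p /andP[/path_cost_ge0 ? _] ->].
Qed.

Lemma dist_cheapest v q : cheapest_path G v q -> dist G v = path_cost G v q.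
Proof.
move=> [vq minq]; apply/eqP; rewrite eq_le dist_le //=; apply: lb_le_inf.
  by exists (path_cost G v q), q.
by move=> _ [p vp ->]; apply: minq.
Qed.

(** This shows that the infimum in [dist] is attained: by induction along the edges, prepend the
    edge minimising cost plus remaining distance. *)
Lemma exists_cheapest_path v : exists q, cheapest_path G v q.
Proof.
elim/edge_ind: v => v IHv; have [->|v_t] := eqVneq v t.
  exists [::]; split=> [|q /andP[/path_cost_ge0]]; first by rewrite /path_to_target /=.
  by rewrite path_cost_nil.
have [w0 evw0] := exists_edge v_t.
case: (@arg_minP _ _ _ w0 (edge G v) (fun w => cost G v w + dist G w)) => // w evw minw.
have [q cwq] := IHv _ evw; have [/andP[ewq /eqP tE] _] := cwq.
exists (w :: q); split=> [|[|u p] /andP[/= evp]].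
- by rewrite /path_to_target /= evw ewq tE eqxx.
- by rewrite (negbTE v_t).
case/andP: evp => evu eup tE'; rewrite !path_cost_cons -(dist_cheapest cwq).
by rewrite (le_trans (minw _ evu)) // lerD2l dist_le // /path_to_target eup.
Qed.

Lemma dist_target : dist G t = 0.
Proof.
have [[|w q] ctq] := exists_cheapest_path t.
  by rewrite (dist_cheapest ctq) path_cost_nil.
by case: ctq => /andP[/=]; rewrite target_sink.
Qed.

Lemma dist_ge0 v : 0 <= dist G v.
Proof.
have [q cq] := exists_cheapest_path v; rewrite (dist_cheapest cq).
by case: cq => /andP[/path_cost_ge0].
Qed.

Lemma dist_edge v w : edge G v w -> dist G v <= cost G v w + dist G w.
Proof.
move=> evw; have [q cq] := exists_cheapest_path w.
rewrite (dist_cheapest cq) -path_cost_cons dist_le //.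
by case: cq => /andP[ewq tE] _; rewrite /path_to_target /= evw ewq.
Qed.

Lemma dist_path v q : path (edge G) v q ->
  dist G v <= path_cost G v q + dist G (last v q).
Proof.
elim: q v => [|w q IHq] v; first by rewrite path_cost_nil add0r.
rewrite path_cost_cons /= => /andP[evw ewq].
by rewrite (le_trans (dist_edge evw)) // -addrA lerD2l IHq.
Qed.

Lemma cheapest_path_cons v w q : cheapest_path G v (w :: q) ->
  edge G v w /\ dist G v = cost G v w + dist G w.
Proof.
move=> cq; have [/andP[/= /andP[evw ewq] tE] _] := cq; split=> //.
apply/eqP; rewrite eq_le dist_edge //= (dist_cheapest cq) path_cost_cons.
by rewrite lerD2l dist_le // /path_to_target ewq.
Qed.

Lemma dist_step v : v != t ->
  exists2 w, edge G v w & dist G v = cost G v w + dist G w.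
Proof.
move=> v_t; have [[|w q] cq] := exists_cheapest_path v.
  by case: cq => /andP[/= _]; rewrite (negbTE v_t).
by have [evw dE] := cheapest_path_cons cq; exists w.
Qed.

(** On an acyclic graph the shortest-path recursion has only one solution; this identifies the
    values computed by the program. *)
Lemma dist_eq (D : V -> R) (succ : V -> V) :
    D t = 0 ->
    (forall v, v != t -> [/\ edge G v (succ v), D v = cost G v (succ v) + D (succ v)
      & forall w, edge G v w -> D v <= cost G v w + D w]) ->
  D =1 dist G.
Proof.
move=> Dt DP; elim/edge_ind=> v IHv.
have [->|v_t] := eqVneq v t; first by rewrite Dt dist_target.
have [evs DE minD] := DP v v_t; have [w evw dE] := dist_step v_t.
apply: le_anti; rewrite {1}dE -IHv // minD //=.
by rewrite DE IHv // dist_edge.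
Qed.

Lemma cheapest_successor_dist (succ : V -> V) :
    (forall v, v != t -> edge G v (succ v)) ->
    (forall v, v != t -> dist G v = cost G v (succ v) + dist G (succ v)) ->
  cheapest_successor G succ.
Proof.
move=> es dE v v_t; have [q cq] := exists_cheapest_path (succ v).
exists q; split=> [|p vp].
  by case: cq => /andP[ewq tE] _; rewrite /path_to_target /= es // ewq.
by rewrite path_cost_cons -(dist_cheapest cq) -dE // dist_le.
Qed.

(** * Perceived costs *)

Variable beta : R.
Hypothesis beta01 : 0 < beta < 1.

Let beta_gt0 : 0 < beta. Proof. by case/andP: beta01. Qed.

Lemma eta_ge0 v w : edge G v w -> 0 <= eta G beta v w.
Proof.
move=> evw; rewrite addr_ge0 ?(task_graph_cost_ge0 tg) //.
by rewrite mulr_ge0 ?dist_ge0 // ltW.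
Qed.

Lemma zeta_le v w : edge G v w -> zeta G beta v <= eta G beta v w.
Proof.
move=> evw; apply: ge_inf; last by exists w.
by exists 0 => _ [u evu ->]; apply: eta_ge0.
Qed.

Lemma zeta_step v : v != t ->
  exists2 w, edge G v w & zeta G beta v = eta G beta v w.
Proof.
move=> /exists_edge[w0 evw0].
case: (@arg_minP _ _ _ w0 (edge G v) (eta G beta v)) => // w evw minw.
exists w => //; apply/eqP; rewrite eq_le zeta_le //=; apply: lb_le_inf.
  by exists (eta G beta v w), w.
by move=> _ [u evu ->]; apply: minw.
Qed.

(** The first edge of a cheapest path is a candidate, and [beta] only discounts what follows it. *)
Lemma zeta_le_dist v : v != t -> zeta G beta v <= dist G v.
Proof.
move=> /dist_step[w evw ->]; rewrite (le_trans (zeta_le evw)) // lerD2l.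
by case/andP: beta01 => _ /ltW b1; rewrite ler_piMl ?dist_ge0.
Qed.

Lemma max_eta_cons v w q : max_eta G beta v (w :: q) =
  Num.max (eta G beta v w) (max_eta G beta w q).
Proof. by rewrite /max_eta /path_edges /= big_cons. Qed.

Lemma max_eta_nil v : max_eta G beta v [::] = 0.
Proof. by rewrite /max_eta /path_edges big_nil. Qed.

Lemma max_eta_ge0 v q : 0 <= max_eta G beta v q.
Proof.
by elim: q v => [|w q IHq] v; rewrite ?max_eta_nil // max_eta_cons le_max IHq orbT.
Qed.

Lemma eta_le_max_eta v q e : e \in path_edges v q ->
  eta G beta e.1 e.2 <= max_eta G beta v q.
Proof. by move=> eq; apply: (@le_bigmax_seq _ _ _ _ _ e). Qed.

End TaskGraphs.

Lemma task_graph_add_cost (R : realType) (V : finType) (G : graph R V) ct :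
  task_graph G -> cost_configuration G ct -> task_graph (add_cost G ct).
Proof.
move=> tg ct0; split=> [p|v|v w evw].
- exact: (task_graph_acyclic tg).
- exact: (task_graph_connected tg).
- by rewrite addr_ge0 ?(task_graph_cost_ge0 tg) ?ct0.
Qed.

(** * The approximation factor *)

Section PathEdges.
Variables (V : finType).
Implicit Types (x v w : V) (p : seq V).

Lemma path_edges_next x p v : v \in x :: p -> v != last x p ->
  exists w, (v, w) \in path_edges x p.
Proof.
elim: p x => [|y p IHp] x; first by rewrite inE /= => ->.
rewrite inE => /predU1P[-> _|vp /(IHp _ vp)[w vw]].
  by exists y; rewrite inE eqxx.
by exists w; rewrite inE [X in _ || X]vw orbT.
Qed.

Lemma path_edges_mem x p v w : (v, w) \in path_edges x p ->
  v \in x :: p /\ w \in p.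
Proof.
elim: p x => [|y p IHp] x //; rewrite inE => /predU1P[[-> ->]|/IHp[vp wp]].
  by rewrite !inE !eqxx.
by rewrite !(inE, vp, wp) ?orbT; rewrite inE in vp; rewrite vp orbT.
Qed.

Lemma path_edges_rel (e : rel V) x p v w : path e x p ->
  (v, w) \in path_edges x p -> e v w.
Proof.
elim: p x => [|y p IHp] x //= /andP[exy eyp].
by rewrite inE => /predU1P[[-> ->]|/(IHp _ eyp)].
Qed.

End PathEdges.

(** * Distances along successor paths *)

Section SuccessorPaths.
Variables (R : realType) (V : finType) (G : graph R V) (succ : V -> V).
Hypotheses (tg : task_graph G) (csucc : cheapest_successor G succ).

Let t := target G.

Lemma succ_edge v : v != t -> edge G v (succ v).
Proof. by move=> /csucc[q /(cheapest_path_cons tg)[]]. Qed.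

Lemma succ_dist v : v != t -> dist G v = cost G v (succ v) + dist G (succ v).
Proof. by move=> /csucc[q /(cheapest_path_cons tg)[]]. Qed.

Lemma succ_path_edge v q : fpath succ v q -> t \notin belast v q ->
  path (edge G) v q.
Proof.
elim: q v => [|w q IHq] v //= /andP[/eqP <- swq]; rewrite inE negb_or => /andP[v_t twq].
by rewrite succ_edge 1?eq_sym //= IHq.
Qed.

Lemma succ_path_dist v q : fpath succ v q -> t \notin belast v q ->
  dist G v = path_cost G v q + dist G (last v q).
Proof.
elim: q v => [|w q IHq] v /=; first by rewrite path_cost_nil add0r.
move=> /andP[/eqP <- swq]; rewrite inE negb_or => /andP[v_t twq].
by rewrite path_cost_cons succ_dist 1?eq_sym // (IHq (succ v)) // addrA.
Qed.

End SuccessorPaths.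

(** * The computed configuration motivates for twice the minmax value *)

Section Approximation.
Variables (R : realType) (V : finType) (G : graph R V) (beta : R).
Variables (ct : V -> V -> R) (p : seq V) (succ : V -> V).
Hypotheses (tg : task_graph G) (beta01 : 0 < beta < 1).

Let s := source G.
Let t := target G.
Let rho := max_eta G beta s p.
Let G' := add_cost G ct.

Hypotheses (minp : minmax_path G beta p) (csucc : cheapest_successor G succ).
Hypothesis ctE : forall v w, edge G v w ->
  [/\ (v, w) \in path_edges s p \/ (w = succ v /\ v \notin s :: p) -> ct v w = 0,
      (v, w) \notin path_edges s p -> w != succ v -> ct v w = 3 * rho / beta
    & v \in s :: p -> w = succ v -> (v, w) \notin path_edges s p ->
        detour_cost G (s :: p) succ v (ct v w)].

Let beta_gt0 : 0 < beta. Proof. by case/andP: beta01. Qed.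

Let rho_ge0 : 0 <= rho. Proof. exact: max_eta_ge0. Qed.

Lemma approx_cost_configuration : cost_configuration G ct.
Proof.
move=> v w evw; have [ct0 ct3 ctd] := ctE evw.
have [vw|vw] := boolP ((v, w) \in path_edges s p); first by rewrite ct0 //; left.
have [ws|ws] := eqVneq w (succ v); last first.
  by rewrite ct3 // divr_ge0 ?mulr_ge0 ?(ltW beta_gt0).
have [vp|vp] := boolP (v \in s :: p); last by rewrite ct0 //; right.
have [q1 [u [q2 [e [[sq _ tq] _ _ [eq _] ->]]]]] := ctd vp ws vw.
move: sq tq; rewrite cat_path belast_cat mem_cat negb_or => /andP[sq _] /andP[tq _].
have [ee _] := path_edgesP tg (succ_path_edge tg csucc sq tq) eq.
exact: (task_graph_cost_ge0 tg).
Qed.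

Let tg' : task_graph G'.
Proof. exact: task_graph_add_cost approx_cost_configuration. Qed.

Lemma minmax_next v : v \in s :: p -> v != t ->
  exists w, [/\ edge G v w, w \in s :: p, ct v w = 0 & eta G beta v w <= rho].
Proof.
have [/andP[esp /eqP tE] _] := minp; rewrite /t -tE => vp v_t.
have [w vw] := path_edges_next vp v_t; have evw := path_edges_rel esp vw.
have [ct0 _ _] := ctE evw; exists w; split=> //.
- by have [_ wp] := path_edges_mem vw; rewrite inE wp orbT.
- by apply: ct0; left.
- exact: (eta_le_max_eta G beta vw).
Qed.

(** Successor edges leaving nodes off the minmax path are free of extra cost, so a detour is charged
    on its first edge only. *)
Lemma add_cost_off_minmax v q u : fpath succ v (rcons q u) ->
    t \notin v :: q -> {in v :: q, forall z, z \notin s :: p} ->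
  path_cost G' v (rcons q u) = path_cost G v (rcons q u).
Proof.
have step z : z != t -> z \notin s :: p -> cost G' z (succ z) = cost G z (succ z).
  move=> z_t zp; have [ct0 _ _] := ctE (succ_edge tg csucc z_t).
  by rewrite /= ct0 ?addr0 //; right.
elim: q v => [|w q IHq] v /= /andP[/eqP <- swq] tvq Poff;
  have v_t : v != t by [apply: contraNneq tvq => ->; apply: mem_head];
  rewrite !path_cost_cons step ?Poff ?mem_head //; first by rewrite !path_cost_nil.
rewrite IHq //; first by move: tvq; rewrite inE negb_or => /andP[].
by move=> z zq; apply: Poff; rewrite inE zq orbT.
Qed.

(** Follow the successor path. An uncharged edge is passed one at a time; a charged one is passed
    together with its whole detour, whose original cost is at least the extra cost. *)
Lemma dist_add_cost v : dist G' v <= 2 * dist G v.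
Proof.
(* Strong induction, because the detour case jumps directly to the return node [u]. *)
have [n] := ubnP (reach G v); elim: n v => // n IHn v /ltnSE le_v_n.
have [->|v_t] := eqVneq v t.
  by rewrite (dist_target tg) mulr0 (dist_target tg').
have evs := succ_edge tg csucc v_t; have [ct0 _ ctd] := ctE evs.
have lt_s : (reach G (succ v) < n)%N by apply: leq_trans le_v_n; apply: reach_edge.
have easy : ct v (succ v) = 0 -> dist G' v <= 2 * dist G v.
  move=> ct0E; rewrite (succ_dist tg csucc v_t).
  have /= := dist_edge tg' (evs : edge G' v (succ v)); rewrite ct0E addr0.
  have := IHn _ lt_s; have := task_graph_cost_ge0 tg evs; lra.
have [vp|vp] := boolP (v \in s :: p); last by apply: easy; apply: ct0; right.
have [vw|vw] := boolP ((v, succ v) \in path_edges s p).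
  by apply: easy; apply: ct0; left.
have [q1 [u [q2 [e [[sq _ tq] q1P uP [eq _] aE]]]]] := ctd vp erefl vw.
move: sq tq; rewrite cat_path belast_cat mem_cat negb_or => /andP[sq _] /andP[tq _].
have edq := succ_path_edge tg csucc sq tq.
have dE := succ_path_dist tg csucc sq tq.
have [_ le_e] := path_edgesP tg edq eq.
have := dist_path tg' (edq : path (edge G') v (rcons q1 u)).
rewrite last_rcons in dE *.
have IHu : dist G' u <= 2 * dist G u.
  apply: IHn; apply: leq_trans le_v_n; case: (q1) edq => [|w q] /=.
    by rewrite andbT; apply: reach_edge.
  by move=> /(reach_path tg); rewrite last_rcons.
suff -> : path_cost G' v (rcons q1 u) = path_cost G v (rcons q1 u) + cost G e.1 e.2.
  by move: dE IHu le_e; lra.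
rewrite -aE; case: (q1) q1P sq tq => [|w q] q1P /=.
  by rewrite andbT => /eqP <- _; rewrite !path_cost_cons !path_cost_nil /= !addr0.
move=> /andP[/eqP wE swq] tq; rewrite !path_cost_cons wE add_cost_off_minmax //.
  by rewrite /= addrAC.
by move: tq; rewrite belast_rcons inE negb_or => /andP[].
Qed.

(* [m] is the extra cost at the entry of the detour: the last inequality holds
   there because the agent accepted the detour, and the distance decreases
   afterwards. *)
Definition on_detour (v : V) : Prop := exists (q : seq V) (u : V) (m : R),
  [/\ fpath succ v (rcons q u), t \notin v :: q, u \in s :: p,
      forall e, e \in path_edges v (rcons q u) -> cost G e.1 e.2 <= m
    & m + beta * dist G' v <= 2 * rho].

(** The edge of the minmax path has no extra cost and distances at most double, so its perceived
    cost at most doubles. *)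
Lemma zeta_minmax_path v : v \in s :: p -> v != t -> zeta G' beta v <= 2 * rho.
Proof.
move=> vp v_t; have [w [evw wp ct0 eta_rho]] := minmax_next vp v_t.
have := zeta_le tg' beta01 (evw : edge G' v w); rewrite /eta /= ct0.
have := dist_add_cost w; rewrite -(ler_pM2l beta_gt0).
have := task_graph_cost_ge0 tg evw; rewrite /eta in eta_rho; lra.
Qed.

(** The division by [beta] in the extra cost keeps the edge unaffordable even when it lies ahead of
    the agent and is discounted. *)
Lemma prohibitive v w : 0 < rho -> edge G v w -> (v, w) \notin path_edges s p ->
  w != succ v -> 2 * rho < beta * cost G' v w.
Proof.
move=> rho_gt0 evw vw ws; have [_ /(_ vw ws) ctvw _] := ctE evw.
rewrite /= ctvw mulrDr [beta * (_ / _)]mulrC divfK ?gt_eqF //.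
have : 0 <= beta * cost G v w by rewrite mulr_ge0 ?(task_graph_cost_ge0 tg) ?ltW.
lra.
Qed.

Lemma prohibitive_eta v w : 0 < rho -> edge G v w -> (v, w) \notin path_edges s p ->
  w != succ v -> 2 * rho < eta G' beta v w.
Proof.
move=> rho_gt0 evw vw ws; apply: lt_le_trans (prohibitive rho_gt0 evw vw ws) _.
have c0 := task_graph_cost_ge0 tg' (evw : edge G' v w).
have d0 : 0 <= beta * dist G' w by rewrite mulr_ge0 ?(dist_ge0 tg') ?ltW.
have : beta * cost G' v w <= cost G' v w by rewrite ler_piMl // ltW //; case/andP: beta01.
by rewrite /eta; lra.
Qed.

(** Within this budget a cheapest path of [G'] cannot start with a prohibitive edge; off the minmax
    path only the successor edge remains. *)
Lemma on_detour_dist_succ v : 0 < rho -> v != t -> v \notin s :: p ->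
  beta * dist G' v <= 2 * rho -> dist G' (succ v) <= dist G' v.
Proof.
move=> rho_gt0 v_t vp dv; have [w evw dE] := dist_step tg' v_t.
have vw : (v, w) \notin path_edges s p by apply: contra vp => /path_edges_mem[].
have [<-|ws] := eqVneq w (succ v).
  by rewrite dE lerDr (task_graph_cost_ge0 tg').
have := prohibitive rho_gt0 evw vw ws; rewrite /G' in dE dv *.
have : 0 <= beta * dist G' w by rewrite mulr_ge0 ?(dist_ge0 tg') ?ltW.
by rewrite dE mulrDr in dv; move: dv; rewrite /G' /=; lra.
Qed.

(** The successor edge costs at most [m] and the distance does not grow across it, so
    [m + beta * dist G' v] bounds its perceived cost. *)
Lemma zeta_on_detour v : 0 < rho -> v \notin s :: p -> on_detour v ->
  zeta G' beta v <= 2 * rho.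
Proof.
move=> rho_gt0 vp [q [u [m [sq tq uP le_m dv]]]].
have v_t : v != t by apply: contraNneq tq => ->; apply: mem_head.
have evs := succ_edge tg csucc v_t.
have [/(_ (or_intror (conj erefl vp))) ct0 _ _] := ctE evs.
have cm : cost G v (succ v) <= m.
  apply: (le_m (v, succ v)).
  by case: (q) sq => [|w q'] /= /andP[/eqP <- _]; rewrite inE eqxx.
have m_ge0 := le_trans (task_graph_cost_ge0 tg evs) cm.
have le_d : dist G' (succ v) <= dist G' v by apply: on_detour_dist_succ => //; lra.
have := zeta_le tg' beta01 (evs : edge G' v (succ v)); rewrite /eta /= ct0.
by rewrite -(ler_pM2l beta_gt0) in le_d; lra.
Qed.

Lemma on_detour_succ v : 0 < rho -> v \notin s :: p -> on_detour v ->
  succ v \in s :: p \/ on_detour (succ v).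
Proof.
move=> rho_gt0 vp [q [u [m [sq tq uP le_m dv]]]].
have v_t : v != t by apply: contraNneq tq => ->; apply: mem_head.
have m_ge0 : 0 <= m.
  have cm : cost G v (succ v) <= m.
    apply: (le_m (v, succ v)).
    by case: (q) sq => [|w q'] /= /andP[/eqP <- _]; rewrite inE eqxx.
  exact: le_trans (task_graph_cost_ge0 tg (succ_edge tg csucc v_t)) cm.
have le_d : dist G' (succ v) <= dist G' v by apply: on_detour_dist_succ => //; lra.
case: q sq tq le_m => [|w q] /= /andP[/eqP wE swq] tq le_m.
  by left; rewrite wE.
right; exists q, u, m; rewrite wE; split=> //.
- by move: tq; rewrite inE negb_or => /andP[].
- by move=> e eq; apply: le_m; rewrite inE [X in _ || X]eq orbT.
- by rewrite -wE; rewrite -(ler_pM2l beta_gt0) in le_d; lra.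
Qed.

(** The extra cost of the entry edge serves as [m]: it is part of the accepted perceived cost and
    dominates every edge of the detour. *)
Lemma minmax_path_detour v : v \in s :: p -> v != t ->
    (v, succ v) \notin path_edges s p -> eta G' beta v (succ v) <= 2 * rho ->
  succ v \in s :: p \/ on_detour (succ v).
Proof.
move=> vp v_t vs le_eta; have evs := succ_edge tg csucc v_t.
have [_ _ /(_ vp erefl vs)] := ctE evs.
move=> [q1 [u [q2 [e [[sq _ tq] _ uP [_ le_e] aE]]]]].
move: sq tq; rewrite cat_path belast_cat mem_cat negb_or => /andP[sq _] /andP[tq _].
move: sq tq le_e; rewrite belast_rcons.
case: q1 => [|w q] /= /andP[/eqP wE swq] tq le_e; first by left; rewrite wE.
right; exists q, u, (cost G e.1 e.2); split=> //; rewrite ?wE //.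
- by move: tq; rewrite inE negb_or => /andP[].
- by move=> f fq; apply: le_e; rewrite inE [X in _ || X]fq orbT.
- have := task_graph_cost_ge0 tg evs; move: le_eta; rewrite /eta /= aE wE; lra.
Qed.

Lemma motivating_approx_gt0 r : 0 < rho -> 2 * rho <= beta * r ->
  motivating G' beta r.
Proof.
move=> rho_gt0 le_r q sq.
(* Invariant of the walk. In both cases [zeta] is at most [2 * rho], so the next edge is not
   prohibitive. *)
have inv : last s q \in s :: p \/ on_detour (last s q).
  elim/last_ind: q sq => [|q w IHq]; first by left; rewrite inE eqxx.
  rewrite rcons_path last_rcons => /andP[/IHq{IHq}].
  set v := last _ q => IHv /and4P[v_t _ evw /eqP etaE].
  have [vp|vp] := boolP (v \in s :: p).
    have le_eta : eta G' beta v w <= 2 * rho by rewrite etaE zeta_minmax_path.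
    have [vw|vw] := boolP ((v, w) \in path_edges s p).
      by left; have [_ wp] := path_edges_mem vw; rewrite inE wp orbT.
    have [wE|ws] := eqVneq w (succ v).
      by rewrite wE in vw le_eta *; apply: minmax_path_detour.
    by have := prohibitive_eta rho_gt0 evw vw ws; rewrite ltNge le_eta.
  have {IHv} dv : on_detour v by case: IHv => // vp'; rewrite vp' in vp.
  have le_eta : eta G' beta v w <= 2 * rho by rewrite etaE zeta_on_detour.
  have vw : (v, w) \notin path_edges s p by apply: contra vp => /path_edges_mem[].
  have [->|ws] := eqVneq w (succ v); first exact: on_detour_succ.
  by have := prohibitive_eta rho_gt0 evw vw ws; rewrite ltNge le_eta.
move=> v_t; apply: le_trans le_r.
have [vp|vp] := boolP (last s q \in s :: p); first exact: zeta_minmax_path.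
by case: inv => [vp'|]; [rewrite vp' in vp|apply: zeta_on_detour].
Qed.

(* If [rho = 0] no edge is prohibitive; instead, the distance to the target stays
   0 along the walk. *)
Lemma motivating_approx_eq0 r : rho = 0 -> 0 <= beta * r -> motivating G' beta r.
Proof.
move=> rho0 r_ge0 q sq.
suff d0 : dist G' (last s q) = 0.
  by move=> /(zeta_le_dist tg' beta01) /le_trans; apply; rewrite d0.
elim/last_ind: q sq => [_|q w IHq].
  have [s_t|s_t] := eqVneq s t; first by rewrite /= -/s s_t; apply: (dist_target tg').
  have [w [esw _ _ ]] := minmax_next (mem_head _ _) s_t.
  have c0 := task_graph_cost_ge0 tg esw; have d0 := dist_ge0 tg w.
  (* The minmax edge out of the source is perceived as 0, so its cost and the distance behind it
     vanish. *)
  rewrite rho0 /eta -/s => eta0.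
  have bd0 : 0 <= beta * dist G w by rewrite mulr_ge0 // ltW.
  have cE : cost G s w = 0 by lra.
  have /eqP : beta * dist G w = 0 by lra.
  rewrite mulf_eq0 gt_eqF //= => /eqP dE.
  apply: le_anti; rewrite (dist_ge0 tg') andbT (le_trans (dist_add_cost _)) //.
  by have := dist_edge tg esw; rewrite -/s cE dE; lra.
rewrite rcons_path last_rcons => /andP[/IHq{IHq}].
set v := last _ q => dv /and4P[v_t _ evw /eqP etaE].
(* [zeta] is at most the distance, which is 0; hence the chosen edge is perceived as 0 and leads to
   distance 0 again. *)
have := zeta_le_dist tg' beta01 v_t; rewrite -etaE dv /eta => eta0.
have c0 := task_graph_cost_ge0 tg' evw; have d0 := dist_ge0 tg' w.
have bd0 : 0 <= beta * dist G' w by rewrite mulr_ge0 // ltW.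
have /eqP : beta * dist G' w = 0 by lra.
by rewrite mulf_eq0 gt_eqF //= => /eqP.
Qed.

Lemma motivating_approx r : 2 * rho <= beta * r -> motivating G' beta r.
Proof.
move: rho_ge0; rewrite le_eqVlt => /predU1P[/esym rho0 le_r|].
  by apply: motivating_approx_eq0 => //; move: le_r; rewrite rho0 mulr0.
exact: motivating_approx_gt0.
Qed.

End Approximation.

(* Extra costs only increase perceived costs, so any walk of a motivated agent
   witnesses a path whose original perceived costs are at most [beta * r]. *)
Lemma minmax_le_motivating (R : realType) (V : finType) (G : graph R V)
    (beta r : R) (ct : V -> V -> R) (p : seq V) :
    task_graph G -> 0 < beta < 1 -> minmax_path G beta p ->
    0 <= r -> cost_configuration G ct -> motivating (add_cost G ct) beta r ->
  max_eta G beta (source G) p <= beta * r.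
Proof.
move=> tg beta01 [_ minp] r_ge0 ct_ge0 mot.
have tg' := task_graph_add_cost tg ct_ge0.
have beta_gt0 : 0 < beta by case/andP: beta01.
have dist_mono w : dist G w <= dist (add_cost G ct) w.
  elim/(edge_ind tg): w => v IHv; have [->|v_t] := eqVneq v (target G).
    by rewrite (dist_target tg) (dist_target tg').
  have [w evw ->] := dist_step tg' v_t; rewrite (le_trans (dist_edge tg evw)) //=.
  by have := IHv _ evw; have := ct_ge0 _ _ evw; lra.
(* Generalised to every node the agent can reach, so that induction along the edges applies: each
   step appends an edge of minimal perceived cost to her walk. *)
suff walk v q : path (agent_step (add_cost G ct) beta r) (source G) q ->
    last (source G) q = v ->
  exists2 p', path_to_target G v p' & max_eta G beta v p' <= beta * r.
  by have [p' sp' /(le_trans (minp _ sp'))] := walk _ [::] isT erefl.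
elim/(edge_ind tg): v q => v IHv q sq vE; have [v_t|v_t] := eqVneq v (target G).
  exists [::]; first by rewrite /path_to_target /= v_t.
  by rewrite max_eta_nil mulr_ge0 // ltW.
have [w evw zE] := zeta_step tg' beta01 v_t.
have zr : zeta (add_cost G ct) beta v <= beta * r by rewrite -vE; apply: mot; rewrite ?vE.
have [|p' wp' le_p'] := IHv w evw (rcons q w) _ (last_rcons _ _ _).
  by rewrite rcons_path sq vE /agent_step /= v_t zr evw zE /=.
exists (w :: p'); first by rewrite /path_to_target /= evw.
rewrite max_eta_cons ge_max le_p' andbT; apply: le_trans zr; rewrite zE /eta /=.
by have := dist_mono w; rewrite -(ler_pM2l beta_gt0); have := ct_ge0 _ _ evw; lra.
Qed.

Lemma minmax_path_approx_motivating (R : realType) (V : finType) (G : graph R V)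
    (beta : R) (ct : V -> V -> R) :
    task_graph G -> 0 < beta < 1 -> minmax_path_approx G beta ct ->
  cost_configuration G ct /\ motivating (add_cost G ct) beta (2 * opt G beta).
Proof.
move=> tg beta01 [p [succ [minp csucc /= ctE]]].
have beta_gt0 : 0 < beta by case/andP: beta01.
have ct_ge0 := approx_cost_configuration tg beta01 csucc ctE.
split=> //; apply: (motivating_approx tg beta01 minp csucc ctE).
suff : max_eta G beta (source G) p / beta <= opt G beta.
  by rewrite ler_pdivrMr // mulrCA ler_pM2l // [beta * _]mulrC.
apply: lb_le_inf => [|r [r_ge0 [ct' ct'_ge0 mot]]]; last first.
  rewrite ler_pdivrMr // mulrC.
  exact: (minmax_le_motivating tg beta01 minp r_ge0 ct'_ge0 mot).
(* The set of rewards must be nonempty for its infimum to be meaningful; the computed configuration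
   itself provides a member. *)
exists (2 * max_eta G beta (source G) p / beta); split.
  by rewrite divr_ge0 ?mulr_ge0 ?max_eta_ge0 // ltW.
exists ct => //; apply: (motivating_approx tg beta01 minp csucc ctE).
by rewrite [beta * _]mulrC divfK // gt_eqF.
Qed.

(** * Programs *)

(** Invariant rule for loops, where the invariant may mention the elements processed so far. *)
Lemma foldl_ind (S T : Type) (f : S -> T -> S) (P : seq T -> S -> Prop)
    (z : S) (l : seq T) :
  P [::] z -> (forall l' x y, P l' y -> P (rcons l' x) (f y x)) ->
  P l (foldl f z l).
Proof.
by move=> P0 PS; elim/last_ind: l => // l x IHl; rewrite foldl_rcons; apply: PS.
Qed.

Lemma exec_polynomial (c : program) : exists q : {poly nat},
  forall (R : realType) (V : finType) (G : graph R V) (beta : R) (st : state R V),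
    ((exec G beta c st).2 <= q.[#|V|])%N.
Proof.
elim: c => [|i e|i e1 e2|i e1 e2 a|c1 [q1 q1P] c2 [q2 q2P]
  |b c1 [q1 q1P] c2 [q2 q2P]|i c [q qP]].
- by exists 1%:P => *; rewrite hornerC.
- by exists (node_steps e).+1%:P => *; rewrite hornerC.
- by exists (node_steps e1 + node_steps e2).+1%:P => *; rewrite hornerC.
- by exists (node_steps e1 + node_steps e2 + num_steps a).+1%:P => *; rewrite hornerC.
- exists (q1 + q2) => R V G beta st; rewrite hornerD /=.
  have := q1P _ _ G beta st; case: exec => st1 n1 /= le1.
  by have := q2P _ _ G beta st1; case: exec => st2 n2 /= le2; apply: leq_add.
- exists ((test_steps b).+1%:P + (q1 + q2)) => R V G beta st.
  rewrite !hornerD hornerC /=.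
  have : ((exec G beta (if eval_test G beta st b then c1 else c2) st).2
           <= q1.[#|V|] + q2.[#|V|])%N.
    case: eval_test; first by apply: leq_trans (q1P _ _ _ _ _) _; apply: leq_addr.
    by apply: leq_trans (q2P _ _ _ _ _) _; apply: leq_addl.
  by case: exec => st1 n1 /= le1; rewrite -addSn leq_add2l.
(* One step to start the loop, and one per iteration on top of the body. *)
- exists (1%:P + 'X * (q + 1%:P)) => R V G beta st /=.
  rewrite !(hornerD, hornerM, hornerX, hornerC); set m := q.[_]; rewrite cardE.
  apply: (@foldl_ind _ _ _ (fun l acc => (acc.2 <= 1 + size l * (m + 1))%N)) => //.
  move=> l v [st1 n1] /= le1; have := qP _ _ G beta (set_reg st1 i v).
  case: exec => st2 n2 /= le2.
  rewrite size_rcons mulSn [(_ + size l * _)%N]addnC addnA -addnS.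
  by rewrite leq_add // addn1 ltnS.
Qed.

(** * Final states without the step count *)

Section Semantics.
Variables (R : realType) (V : finType) (G : graph R V) (beta : R).
Implicit Types (st : state R V) (c : program).

Definition run c st : state R V := (exec G beta c st).1.

Lemma run_seq c1 c2 st : run (PSeq c1 c2) st = run c2 (run c1 st).
Proof. by rewrite /run /=; case: exec => st1 n1 /=; case: exec. Qed.

Lemma run_if b c1 c2 st : run (PIf b c1 c2) st =
  if eval_test G beta st b then run c1 st else run c2 st.
Proof. by rewrite /run /=; case: eval_test; case: exec. Qed.

Lemma run_for i c st : run (PForEach i c) st =
  foldl (fun st' v => run c (set_reg st' i v)) st (enum V).
Proof.
rewrite /run /=; move: 1%N; elim: (enum V) st => //= v l IHl st n.
by case: (exec _ _ _ (set_reg st i v)) => st1 n1 /=; rewrite IHl.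
Qed.

End Semantics.

(** ** Dynamic programming on an acyclic graph *)

(* Registers: 0 is the node [v] to update, 1 a candidate successor [w], 2 the
   best successor found so far ([v] itself if there is none), 3 is the round.
   The value of [v] is stored in entry [(v, v)] of table [d]; table [k] holds
   the values that the choice of [w] would give to [v]. *)
Definition select_prog (k : nat) (allowed : test) (key : program) : program :=
  PForEach 1
    (PIf allowed
       (PSeq key
          (PIf (TAnd (TNot (TEq (NReg 2) (NReg 0)))
                     (TLe (RTab k (NReg 0) (NReg 2)) (RTab k (NReg 0) (NReg 1))))
             PSkip (PSetReg 2 (NReg 1))))
       PSkip).

Definition update_prog (n d k : nat) (allowed : test) (key : program) : program :=
  PSeq (PSetReg 2 (NReg 0))
 (PSeq (select_prog k allowed key)
 (PSeq (PSetNode n (NReg 0) (NReg 2))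
       (PIf (TEq (NReg 2) (NReg 0))
          (PSetNum d (NReg 0) (NReg 0) RZero)
          (PSetNum d (NReg 0) (NReg 0) (RTab k (NReg 0) (NReg 2)))))).

Definition dp_prog (n d k : nat) (allowed : test) (key : program) : program :=
  PForEach 3 (PForEach 0 (update_prog n d k allowed key)).

Section DynamicProgramming.
Variables (R : realType) (V : finType) (G : graph R V) (beta : R).
Hypothesis tg : task_graph G.
Variables (n d k : nat) (dk : d != k).
Implicit Types st : state R V.

(** Only the tables owned by the dynamic program may change, so [allowed] and [key] can rely on all
    other tables. Registers are left unconstrained. *)
Definition frame st st' : Prop :=
  (forall l x y, l \notin [:: d; k] -> num_table st' l x y = num_table st l x y) /\
  (forall l x, l != n -> node_table st' l x = node_table st l x).

Variables (allowed : test) (key : program) (st0 : state R V).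
Variables (al : rel V) (f : V -> V -> R -> R).
Hypothesis al_edge : subrel al (edge G).
Hypothesis allowedE : forall st, frame st0 st ->
  eval_test G beta st allowed = al (reg st 0) (reg st 1).
Hypothesis keyE : forall st, frame st0 st ->
  run G beta key st = set_num st k (reg st 0) (reg st 1)
    (f (reg st 0) (reg st 1) (num_table st d (reg st 1) (reg st 1))).

Definition dval st (v : V) : R := num_table st d v v.

(** The optimality equation at [v], with [succ] recording a minimiser. A self-pointer unambiguously
    encodes the lack of allowed edges, since these are never loops. *)
Definition bellman (D : V -> R) (succ : V -> V) (v : V) : Prop :=
  [/\ forall w, ~~ al v w, D v = 0 & succ v = v] \/
  [/\ al v (succ v), D v = f v (succ v) (D (succ v))
    & forall w, al v w -> D v <= f v w (D w)].

Let al_irrefl v : al v v = false.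
Proof. by apply: contraFF (edge_irrefl tg v); apply: al_edge. Qed.

Lemma select_ok st v : frame st0 st -> reg st 0 = v -> reg st 2 = v ->
  let st' := run G beta (select_prog k allowed key) st in
  [/\ frame st0 st', reg st' 0 = v, num_table st' d = num_table st d,
      node_table st' n = node_table st n
    & if reg st' 2 == v then forall w, ~~ al v w else
      [/\ al v (reg st' 2),
          num_table st' k v (reg st' 2) = f v (reg st' 2) (dval st (reg st' 2))
        & forall w, al v w ->
            f v (reg st' 2) (dval st (reg st' 2)) <= f v w (dval st w)]].
Proof.
move=> fr regv rega st'; rewrite /st' /select_prog run_for {st'}.
set body := PIf _ _ _.
(* Table [k] has to stay correct for all candidates seen, because later comparisons read the entry
   of the current best one. *)
pose P (l : seq V) st' := [/\ frame st0 st', reg st' 0 = v, num_table st' d = num_table st d,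
      node_table st' n = node_table st n
    & (forall w, w \in l -> al v w -> num_table st' k v w = f v w (dval st w)) /\
      if reg st' 2 == v then forall w, w \in l -> ~~ al v w else
      [/\ al v (reg st' 2), reg st' 2 \in l
        & forall w, w \in l -> al v w ->
            f v (reg st' 2) (dval st (reg st' 2)) <= f v w (dval st w)]].
suff: P (enum V) (foldl (fun st' w => run G beta body (set_reg st' 1 w)) st (enum V)).
  case=> fr' rv dE nE [kE aE]; split=> //; case: ifP aE => _.
    by move=> noal w; apply: noal; rewrite mem_enum.
  case=> ala _ mina; split=> // [|w]; last by apply: mina; rewrite mem_enum.
  by apply: kE; rewrite ?mem_enum.
apply: foldl_ind => [|l w st1 [fr1 rv dE nE [kE aE]]].
  by split=> //; split=> //; rewrite rega eqxx.
set st2 := set_reg st1 1 w.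
have fr2 : frame st0 st2 by [].
rewrite /body run_if allowedE //= rv; case: ifP => [alw|nalw]; last first.
  split=> //; split=> [u|]; rewrite /=.
    by rewrite mem_rcons inE => /predU1P[->|/kE//]; rewrite nalw.
  case: eqP aE => [_ aE u|_ [ala al_l mina]]; rewrite ?mem_rcons ?inE.
    by move=> /predU1P[->|/aE//]; rewrite nalw.
  split=> //; first by rewrite al_l orbT.
  by move=> u; rewrite mem_rcons inE => /predU1P[->|/mina//]; rewrite nalw.
have wv : (w == v) = false by apply: contraTF alw => /eqP ->; rewrite al_irrefl.
rewrite run_seq keyE //= rv dE -/(dval st w); set x := f v w _.
have kE' : forall u, u \in rcons l w -> al v u ->
    num_table (set_num st2 k v w x) k v u = f v u (dval st u).
  move=> u; rewrite mem_rcons inE /= !eqxx /=; case: eqVneq => [-> //|_ /=].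
  exact: kE.
have fr3 : frame st0 (set_num st2 k v w x).
  split=> [l' y z|l' y]; last by apply: (proj2 fr2).
  rewrite !inE negb_or => /andP[ld lk] /=; rewrite (negbTE lk) /=.
  by apply: (proj1 fr2); rewrite !inE negb_or ld.
have dE3 : num_table (set_num st2 k v w x) d = num_table st d.
  by rewrite /= (negbTE dk) /= -dE.
rewrite run_if /= rv.
have leE : reg st1 2 != v -> reg st1 2 \in l -> al v (reg st1 2) ->
   (if [&& k == k, v == v & reg st1 2 == w] then x else num_table st1 k v (reg st1 2))
   = f v (reg st1 2) (dval st (reg st1 2)).
  by move=> av al_l ala; rewrite !eqxx /=; case: eqVneq => [->//|_]; apply: kE.
case: eqVneq aE leE => [av aE _|av [ala al_l mina] /(_ isT al_l ala) ->] /=.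
  split=> //; split=> //=; rewrite wv; split=> //; first by rewrite mem_rcons mem_head.
  by move=> u; rewrite mem_rcons inE => /predU1P[-> //|/aE/negP].
rewrite !eqxx /=; case: ifP => le_x.
  split=> //; split=> //=; rewrite (negbTE av); split=> //.
    by rewrite mem_rcons inE al_l orbT.
  by move=> u; rewrite mem_rcons inE => /predU1P[-> //|/mina].
split=> //; split=> //=; rewrite wv; split=> //; first by rewrite mem_rcons mem_head.
have {}le_x : x <= f v (reg st1 2) (dval st (reg st1 2)).
  by rewrite leNgt; apply/negP=> /ltW; rewrite le_x.
move=> u; rewrite mem_rcons inE => /predU1P[-> //|/mina le_u /le_u].
exact: le_trans.
Qed.

(** No allowed edge is a loop, so writing the entry of [v] does not disturb the values that its own
    equation reads. *)
Lemma update_ok st v : frame st0 st -> reg st 0 = v ->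
  let st' := run G beta (update_prog n d k allowed key) st in
  [/\ frame st0 st', bellman (dval st') (node_table st' n) v,
      forall u, u != v -> dval st' u = dval st u
    & forall u, u != v -> node_table st' n u = node_table st n u].
Proof.
move=> fr rv st'; rewrite /st' {st'} /update_prog run_seq.
have fr1 : frame st0 (run G beta (PSetReg 2 (NReg 0)) st) by [].
have [] := select_ok fr1 rv rv.
rewrite run_seq; set st1 := run _ _ (select_prog _ _ _) _ => fr' rv1 /= dE nE aE.
rewrite run_seq run_if /= rv1.
have fin x : let st' := set_num (set_node st1 n v (reg st1 2)) d v v x in
    [/\ frame st0 st', dval st' v = x, node_table st' n v = reg st1 2,
        forall u, u != v -> dval st' u = dval st u
      & forall u, u != v -> node_table st' n u = node_table st n u].
  split=> [|||u uv|u uv].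
  - split=> [l y z|l y ln] /=.
      rewrite !inE negb_or => /andP[ld lk].
      by rewrite (negbTE ld) /= (proj1 fr') // !inE negb_or ld.
    by rewrite (negbTE ln) /= (proj2 fr').
  - by rewrite /dval /= !eqxx.
  - by rewrite /= !eqxx.
  - by rewrite /dval /= (negbTE uv) !andbF dE.
  - by rewrite /= (negbTE uv) andbF nE.
case: eqP aE => [av noal|/eqP av [ala kE mina]]; rewrite /run [exec _ _ _ _]/= rv1.
  have [fr2 dv nv dE' nE'] := fin 0; split=> //.
  by left; rewrite nv.
move: (fin (num_table st1 k v (reg st1 2))); set st2 := set_num _ _ _ _ _.
move=> [fr2 dv nv dE' nE']; rewrite -/st2; split=> //; right.
rewrite nv dv kE dE' //; split=> // w alw.
rewrite dE'; first exact: mina.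
by apply: contraTneq alw => ->; rewrite al_irrefl.
Qed.

(** Ties may give different minimisers, but the minimum depends only on the values at the allowed
    successors. *)
Lemma bellman_unique D succ D' succ' v : bellman D succ v -> bellman D' succ' v ->
  (forall w, al v w -> D w = D' w) -> D v = D' v.
Proof.
move=> [[noal -> _]|[als DE minD]] [[noal' -> _]|[als' DE' minD']] eqD //.
- by have := noal (succ' v); rewrite als'.
- by have := noal' (succ v); rewrite als.
- by apply: le_anti; rewrite {1}DE' -eqD // minD //= DE eqD // minD'.
Qed.

(** If the equation at [u] reads the value of [v], the equation at [v] held before, and recomputing
    it reproduces the same value. *)
Lemma update_bellman st v u : frame st0 st -> reg st 0 = v -> u != v ->
  let st' := run G beta (update_prog n d k allowed key) st in
  (al u v -> bellman (dval st) (node_table st n) v) ->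
  bellman (dval st) (node_table st n) u -> bellman (dval st') (node_table st' n) u.
Proof.
move=> fr rv uv st' bv bu; have [_ bv' dE nE] := update_ok fr rv.
have eqD w : al u w -> dval st' w = dval st w.
  move=> alw; have [wv|/dE//] := eqVneq w v; rewrite wv in alw *.
  apply: bellman_unique bv' (bv alw) _ => x alx; apply: dE.
  by apply: contraTneq alx => ->; rewrite al_irrefl.
case: bu => [[noal du nu]|[als du minu]]; [left | right].
  by rewrite dE // nE.
rewrite nE // dE // eqD //; split=> // w alw; rewrite eqD //; exact: minu.
Qed.

(* After [i] rounds all nodes that reach at most [i] nodes have their final
   value. *)
Lemma dp_ok : let st := run G beta (dp_prog n d k allowed key) st0 in
  frame st0 st /\ forall v, bellman (dval st) (node_table st n) v.
Proof.
rewrite /dp_prog run_for.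
set body := fun _ _ => _; pose P (l : seq V) st := frame st0 st /\ forall v,
  (reach G v <= size l)%N -> bellman (dval st) (node_table st n) v.
suff: P (enum V) (foldl body st0 (enum V)).
  by case=> fr bell; split=> // v; apply: bell; rewrite -cardE max_card.
apply: foldl_ind => [|l x st [fr bell]].
  (* Before the first round the claim is vacuous: every node reaches itself. *)
  by split=> // v; rewrite leqNgt reach_gt0.
rewrite /P /body run_for {P body}.
(* Within a round, nodes settled earlier stay settled, and those of the next rank become settled
   once visited. *)
set body := fun _ _ => _; pose P (l' : seq V) st' := frame st0 st' /\ forall v,
  (reach G v <= size l)%N || ((v \in l') && (reach G v <= (size l).+1)%N) ->
  bellman (dval st') (node_table st' n) v.
suff: P (enum V) (foldl body (set_reg st 3 x) (enum V)).
  case=> fr' bell'; split=> // v; rewrite size_rcons => le_v.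
  by apply: bell'; rewrite mem_enum le_v orbT.
apply: foldl_ind => [|l' v st' [fr' bell']].
  by split=> // v; rewrite orbF; apply: bell.
have fr2 : frame st0 (set_reg st' 0 v) by [].
rewrite /body; have [fr3 bv _ _] := update_ok fr2 erefl.
split=> // u u_l; have [-> //|uv] := eqVneq u v.
apply: update_bellman => // [/al_edge/(reach_edge tg) lt_vu|]; apply: bell'.
  move: u_l; rewrite mem_rcons inE (negbTE uv) /= => /orP[le_u|/andP[_ le_u]].
    by rewrite (ltnW (leq_trans lt_vu le_u)).
  by rewrite -ltnS (leq_trans lt_vu le_u).
by move: u_l; rewrite mem_rcons inE (negbTE uv).
Qed.

End DynamicProgramming.

(** ** The program for MinMaxPathApprox *)

Section FunctionPaths.
Variables (R : realType) (V : finType) (G : graph R V) (succ : V -> V).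
Hypothesis tg : task_graph G.

Let t := target G.

Hypothesis succ_edge : forall v, v != t -> edge G v (succ v).

(** The length bound ensures that [#|V|] iterations suffice to mark the path. *)
Lemma exists_successor_path v : exists2 p,
  successor_path G succ v p & (size p < reach G v)%N.
Proof.
elim/(edge_ind tg): v => v IHv; have [->|v_t] := eqVneq v t.
  by exists [::]; rewrite ?reach_gt0.
have evs := succ_edge v_t; have [p [sp lp tp] lt_p] := IHv _ evs.
exists (succ v :: p); last by rewrite /= (leq_ltn_trans lt_p) // reach_edge.
by split; rewrite //= ?eqxx // inE negb_or eq_sym v_t.
Qed.

Lemma successor_path_edges v p : successor_path G succ v p ->
  path_to_target G v p.
Proof.
move=> [sp lp tp]; rewrite /path_to_target lp eqxx andbT.
elim: p v sp {lp} tp => //= w p IHp v /andP[/eqP <- sp].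
by rewrite inE negb_or eq_sym => /andP[v_t tp]; rewrite succ_edge //= IHp.
Qed.

(** Marks on nodes thus suffice to decide which edges lie on the path. *)
Lemma successor_path_edgesE v p u : successor_path G succ v p -> u != t ->
  ((u, succ u) \in path_edges v p) = (u \in v :: p).
Proof.
move=> [sp lp tp] u_t; apply/idP/idP => [/path_edges_mem[]//|up].
have [|w uw] := path_edges_next up; first by rewrite lp.
by have /eqP -> := path_edges_rel sp uw.
Qed.

Lemma successor_path_traject v p : successor_path G succ v p ->
  v :: p = traject succ v (size p).+1.
Proof. by case=> sp _ _; case/fpathP: sp => m ->; rewrite size_traject. Qed.

(** As the target is a fixed point, surplus iterations of the marking loop never leave the path. *)
Lemma iter_successor_path v p m : successor_path G succ v p -> succ t = t ->
  iter m succ v \in v :: p.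
Proof.
move=> [sp lp tp] succ_t; elim: m => [|m IHm]; first exact: mem_head.
rewrite iterS; have [->|m_t] := eqVneq (iter m succ v) t.
  by rewrite succ_t /t -lp mem_last.
have [|w uw] := path_edges_next IHm; first by rewrite lp.
have /eqP -> := path_edges_rel sp uw.
by have [_ wp] := path_edges_mem uw; rewrite inE wp orbT.
Qed.

End FunctionPaths.

(** * Solutions of the three recursions *)

Section Bellman.
Variables (R : realType) (V : finType) (G : graph R V).
Hypothesis tg : task_graph G.
Variables (al : rel V) (f : V -> V -> R -> R) (D : V -> R) (succ : V -> V).
Hypothesis al_edge : subrel al (edge G).
Hypothesis bell : forall v, bellman al f D succ v.

Let t := target G.

Lemma bellman_target : D t = 0 /\ succ t = t.
Proof.
by case: (bell t) => [[]//|[/al_edge]]; rewrite (target_sink tg).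
Qed.

Lemma bellman_edge v w : al v w ->
  [/\ al v (succ v), D v = f v (succ v) (D (succ v))
    & forall w, al v w -> D v <= f v w (D w)].
Proof. by move=> alw; case: (bell v) => // -[noal]; rewrite (negbTE (noal w)) in alw. Qed.

End Bellman.

Section Minmax.
Variables (R : realType) (V : finType) (G : graph R V) (beta : R).
Variables (D : V -> R) (succ : V -> V).
Hypothesis tg : task_graph G.
Hypothesis bell : forall v,
  bellman (edge G) (fun v w x => Num.max (eta G beta v w) x) D succ v.

Let t := target G.

Lemma bellman_minmax_le v q : path_to_target G v q -> D v <= max_eta G beta v q.
Proof.
have [Dt _] := bellman_target tg (fun _ _ => id) bell.
elim: q v => [|w q IHq] v /andP[/= evq /eqP tE].
  by rewrite tE Dt max_eta_nil.
case/andP: evq => evw ewq; have [_ _ minD] := bellman_edge bell evw.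
rewrite (le_trans (minD _ evw)) // max_eta_cons ge_max !le_max lexx /=.
by rewrite IHq ?orbT // /path_to_target ewq tE eqxx.
Qed.

Lemma bellman_minmax_path v p : successor_path G succ v p ->
  max_eta G beta v p = D v.
Proof.
have [Dt _] := bellman_target tg (fun _ _ => id) bell.
case=> sp lp tp; elim: p v sp lp tp => [|w p IHp] v /=.
  by move=> _ -> _; rewrite max_eta_nil Dt.
move=> /andP[/eqP <- sp] lp; rewrite inE negb_or eq_sym => /andP[v_t tp].
have [w' evw] := exists_edge tg v_t; have [_ DE _] := bellman_edge bell evw.
by rewrite max_eta_cons IHp.
Qed.

Lemma bellman_minmax p : successor_path G succ (source G) p ->
  minmax_path G beta p.
Proof.
move=> sp; split=> [|q sq].
  apply: successor_path_edges sp => v v_t.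
  by have [w evw] := exists_edge tg v_t; have [] := bellman_edge bell evw.
by rewrite (bellman_minmax_path sp) bellman_minmax_le.
Qed.

End Minmax.

Section Detours.
Variables (R : realType) (V : finType) (G : graph R V) (succ : V -> V).
Variables (D : V -> R) (succ' : V -> V) (P : seq V).
Hypothesis tg : task_graph G.

Let t := target G.

Hypothesis succ_edge : forall v, v != t -> edge G v (succ v).
Hypothesis tP : t \in P.
Hypothesis bell : forall v, bellman (fun v w => edge G v w && (w == succ v))
  (fun v w x => if w \in P then cost G v w else Num.max (cost G v w) x) D succ' v.

(** With one allowed edge per node, the recursion just takes the maximal cost along the successor
    path up to its first node in [P]. Starting nodes off [P] are included so that the induction can
    run inside a detour. *)
Lemma bellman_detour v : v != t -> detour_cost G P succ v (D v).
Proof.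
elim/(edge_ind tg): v => v IHv v_t; have evs := succ_edge v_t.
have als : edge G v (succ v) && (succ v == succ v) by rewrite evs /=.
have [/andP[_ /eqP ->] -> _] := bellman_edge bell als.
have [sP|sP] := boolP (succ v \in P).
  have [q [sq lq tq] _] := exists_successor_path tg succ_edge (succ v).
  exists [::], (succ v), q, (v, succ v); split=> //.
    by split; rewrite //= ?eqxx // inE negb_or eq_sym v_t.
  by split=> [|e]; rewrite /path_edges /= inE // => /eqP ->.
have s_t : succ v != t by apply: contraNneq sP => ->.
have [q1 [u [q2 [e [[sq lq tq] q1P uP [eq le_e] DE]]]]] := IHv _ evs s_t.
exists (succ v :: q1), u, q2,
  (if cost G v (succ v) <= D (succ v) then e else (v, succ v)).
split=> //.
- by split; rewrite //= ?eqxx // inE negb_or eq_sym v_t.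
- by move=> z; rewrite inE => /predU1P[->|/q1P].
- rewrite rcons_cons.
  split=> [|e'];
    rewrite -[path_edges _ _]/((v, succ v) :: path_edges (succ v) (rcons q1 u)).
    by case: ifP => _; rewrite inE ?eq ?eqxx ?orbT.
  rewrite inE => /predU1P[->|/le_e le_e'].
    by case: ifP => //=; rewrite DE.
  by case: ifP => //= /negbT; rewrite -ltNge DE => /ltW; apply: le_trans.
- by rewrite maxEle; case: ifP; rewrite // DE.
Qed.

End Detours.

(** * The program text *)

Definition edge_test : test := TEdge (NReg 0) (NReg 1).
Definition edge_cost : num_expr := RCost (NReg 0) (NReg 1).

Definition dist_prog : program := dp_prog 0 1 2 edge_test
  (PSetNum 2 (NReg 0) (NReg 1) (RAdd edge_cost (RTab 1 (NReg 1) (NReg 1)))).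

Definition eta_expr : num_expr :=
  RAdd edge_cost (RMulBeta (RTab 1 (NReg 1) (NReg 1))).

Definition minmax_prog : program := dp_prog 1 3 4 edge_test
  (PIf (TLe eta_expr (RTab 3 (NReg 1) (NReg 1)))
     (PSetNum 4 (NReg 0) (NReg 1) (RTab 3 (NReg 1) (NReg 1)))
     (PSetNum 4 (NReg 0) (NReg 1) eta_expr)).

(** Register 4 follows node table 1 from the source; register 3 only counts iterations. *)
Definition mark_prog : program :=
  PSeq (PSetReg 4 NSource)
    (PForEach 3 (PSeq (PSetNum 7 (NReg 4) (NReg 4) ROne)
                      (PSetReg 4 (NTab 1 (NReg 4))))).

Definition marked (e : node_expr) : test := TLe ROne (RTab 7 e e).

(** The test admits only the successor edge, so the minimisation built into [dp_prog] is trivial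
    here. *)
Definition detour_prog : program :=
  dp_prog 2 5 6 (TAnd edge_test (TEq (NReg 1) (NTab 0 (NReg 0))))
  (PIf (marked (NReg 1)) (PSetNum 6 (NReg 0) (NReg 1) edge_cost)
    (PIf (TLe edge_cost (RTab 5 (NReg 1) (NReg 1)))
     (PSetNum 6 (NReg 0) (NReg 1) (RTab 5 (NReg 1) (NReg 1)))
     (PSetNum 6 (NReg 0) (NReg 1) edge_cost))).

Definition rho_expr : num_expr := RTab 3 NSource NSource.

Definition set_extra_cost (a : num_expr) : program :=
  PSetNum 0 (NReg 0) (NReg 1) a.

(** Edges of the minmax path are tested first, since they may be successor edges too. The factor 3
    is written as a repeated sum. *)
Definition output_prog : program :=
  PForEach 0 (PForEach 1
    (PIf (TAnd (marked (NReg 0)) (TEq (NReg 1) (NTab 1 (NReg 0))))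
       (set_extra_cost RZero)
    (PIf (TEq (NReg 1) (NTab 0 (NReg 0)))
       (PIf (marked (NReg 0)) (set_extra_cost (RTab 5 (NReg 0) (NReg 0)))
          (set_extra_cost RZero))
       (set_extra_cost (RDivBeta (RAdd rho_expr (RAdd rho_expr rho_expr))))))).

(* Number tables: 0 is the output, the diagonals of 1, 3 and 5 hold the distances
   to the target, the minmax values and the detour costs, the diagonal of 7 marks
   the minmax path.  Node tables: 0 is the successor function on cheapest paths,
   1 the one on minmax paths. *)
Definition minmax_path_approx_prog : program :=
  PSeq dist_prog (PSeq minmax_prog (PSeq mark_prog (PSeq detour_prog output_prog))).

(** * Correctness of the program *)

Section ProgramCorrect.
Variables (R : realType) (V : finType) (G : graph R V) (beta : R).
Hypothesis tg : task_graph G.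
Implicit Types st : state R V.

(** Agreement on allowed edges is enough, which removes the guard that [RCost] puts on non-edges. *)
Lemma eq_bellman (al : rel V) f f' (D D' : V -> R) succ v : D =1 D' ->
  (forall w x, al v w -> f v w x = f' v w x) ->
  bellman al f D succ v -> bellman al f' D' succ v.
Proof.
move=> eqD eqf [[noal Dv sv]|[als DE minD]]; first by left; rewrite -eqD.
right; split=> // [|w alw]; rewrite -!eqD -eqf //; exact: minD.
Qed.

Lemma dist_prog_ok st : let st' := run G beta dist_prog st in
  frame 0 1 2 st st' /\
  forall v, bellman (edge G) (fun v w x => cost G v w + x)
    (dval 1 st') (node_table st' 0) v.
Proof.
have [//|//|//|fr bell] := @dp_ok _ _ G beta tg 0 1 2 isT edge_test
  (PSetNum 2 (NReg 0) (NReg 1) (RAdd edge_cost (RTab 1 (NReg 1) (NReg 1)))) st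
  (edge G) (fun v w x => (if edge G v w then cost G v w else 0) + x).
by split=> // v; apply: eq_bellman (bell v) => // w x /= ->.
Qed.

Lemma minmax_prog_ok st : let st' := run G beta minmax_prog st in
  frame 1 3 4 st st' /\
  forall v, bellman (edge G)
    (fun v w x => Num.max (cost G v w + beta * dval 1 st w) x)
    (dval 3 st') (node_table st' 1) v.
Proof.
have [//|//|st1 fr|fr bell] := @dp_ok _ _ G beta tg 1 3 4 isT edge_test
  (PIf (TLe eta_expr (RTab 3 (NReg 1) (NReg 1)))
     (PSetNum 4 (NReg 0) (NReg 1) (RTab 3 (NReg 1) (NReg 1)))
     (PSetNum 4 (NReg 0) (NReg 1) eta_expr)) st
  (edge G) (fun v w x => Num.max
    ((if edge G v w then cost G v w else 0) + beta * dval 1 st w) x).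
  by rewrite run_if /dval -(proj1 fr 1%N) // maxEle /=; case: ifP.
by split=> // v; apply: eq_bellman (bell v) => // w x /= ->.
Qed.

Lemma detour_prog_ok st (P : seq V) :
  (forall v, num_table st 7 v v = (v \in P)%:R) ->
  let st' := run G beta detour_prog st in
  frame 2 5 6 st st' /\
  forall v, bellman (fun v w => edge G v w && (w == node_table st 0 v))
    (fun v w x => if w \in P then cost G v w else Num.max (cost G v w) x)
    (dval 5 st') (node_table st' 2) v.
Proof.
move=> markP.
have [|st1 fr|st1 fr|fr bell] := @dp_ok _ _ G beta tg 2 5 6 isT
  (TAnd edge_test (TEq (NReg 1) (NTab 0 (NReg 0))))
  (PIf (marked (NReg 1)) (PSetNum 6 (NReg 0) (NReg 1) edge_cost)
    (PIf (TLe edge_cost (RTab 5 (NReg 1) (NReg 1)))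
     (PSetNum 6 (NReg 0) (NReg 1) (RTab 5 (NReg 1) (NReg 1)))
     (PSetNum 6 (NReg 0) (NReg 1) edge_cost))) st
  (fun v w => edge G v w && (w == node_table st 0 v))
  (fun v w x => let c := if edge G v w then cost G v w else 0 in
    if w \in P then c else Num.max c x).
- by move=> v w /andP[].
- by rewrite /= (proj2 fr).
- rewrite !run_if /= (proj1 fr 7%N) // markP ler1n lt0b maxEle.
  by case: ifP => //; case: ifP.
by split=> // v; apply: eq_bellman (bell v) => // w x /andP[/= -> _] //.
Qed.

Lemma mark_prog_ok st (p : seq V) :
    successor_path G (node_table st 1) (source G) p -> (size p < #|V|)%N ->
    node_table st 1 (target G) = target G ->
    (forall v, num_table st 7 v v = 0) ->
  let st' := run G beta mark_prog st in
  [/\ node_table st' = node_table st,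
      forall l, l != 7%N -> num_table st' l = num_table st l
    & forall v, num_table st' 7 v v = (v \in source G :: p)%:R].
Proof.
move=> sp lt_p next_t mark0 st'; rewrite /st' {st'} /mark_prog run_seq run_for.
set nxt := node_table st 1; set s := source G; set body := fun _ _ => _.
pose P (l : seq V) st' := [/\ node_table st' = node_table st,
   reg st' 4 = iter (size l) nxt s,
   forall l, l != 7%N -> num_table st' l = num_table st l
 & forall v, num_table st' 7 v v = (v \in traject nxt s (size l))%:R].
suff: P (enum V) (foldl body (run G beta (PSetReg 4 NSource) st) (enum V)).
  case=> nE _ tE mE; split=> // v; rewrite mE -cardE; congr (nat_of_bool _)%:R.
  (* Nothing off the path is marked because the target is a fixed point; nothing on it is missed
     because it has at most [#|V|] nodes. *)
  apply/idP/idP => [/trajectP[i _ ->]|]; first exact: (iter_successor_path i sp next_t).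
  rewrite (successor_path_traject sp) => /trajectP[i lt_i ->].
  by apply/trajectP; exists i => //; apply: leq_trans lt_i _.
apply: foldl_ind => [|l x st' [nE rE tE mE]]; first by split=> // v; rewrite mark0.
rewrite /body run_seq /run /= rE; split=> //=.
- by rewrite size_rcons iterS nE.
- by move=> l' l'7; apply/funext=> v; apply/funext=> w; rewrite (negbTE l'7) /= tE.
- move=> v; rewrite size_rcons trajectSr mem_rcons inE andbb.
  by case: eqVneq => //= _; apply: mE.
Qed.

Lemma output_prog_ok st (P : seq V) :
    (forall v, num_table st 7 v v = (v \in P)%:R) ->
  let st' := run G beta output_prog st in
  forall v w, num_table st' 0 v w =
    if (v \in P) && (w == node_table st 1 v) then 0
    else if w == node_table st 0 v then
      if v \in P then dval 5 st v else 0
    else 3 * dval 3 st (source G) / beta.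
Proof.
move=> markP st'; rewrite /st' {st'} /output_prog run_for.
pose out v w := if (v \in P) && (w == node_table st 1 v) then 0
  else if w == node_table st 0 v then if v \in P then dval 5 st v else 0
  else 3 * dval 3 st (source G) / beta.
set body := PIf _ _ _.
pose same st' := node_table st' = node_table st /\
  forall l, l != 0%N -> num_table st' l = num_table st l.
have bodyE st' : same st' -> run G beta body st' =
    set_num st' 0 (reg st' 0) (reg st' 1) (out (reg st' 0) (reg st' 1)).
  case=> nE tE; rewrite /body !run_if /= !tE // nE markP ler1n lt0b /out.
  case: ifP => //= _; case: ifP => //= _; first by case: ifP => _; rewrite /run /= ?tE.
  by rewrite /run /= !tE // /dval; congr (set_num _ _ _ _ (_ / _)); lra.
(* The outer invariant [Q] records finished rows, the inner [Q'] the finished entries of row [v]. *)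
pose Q (l : seq V) st' := same st' /\
  forall v w, v \in l -> num_table st' 0 v w = out v w.
suff: Q (enum V) (foldl (fun st' v => run G beta (PForEach 1 body) (set_reg st' 0 v))
                   st (enum V)).
  by case=> _ outE v w; apply: outE; rewrite mem_enum.
apply: foldl_ind => // l v st1 [same1 out1]; rewrite run_for.
pose Q' (l' : seq V) st' := [/\ same st', reg st' 0 = v,
  forall u w, u \in l -> num_table st' 0 u w = out u w
  & forall w, w \in l' -> num_table st' 0 v w = out v w].
suff: Q' (enum V) (foldl (fun st' w => run G beta body (set_reg st' 1 w))
                    (set_reg st1 0 v) (enum V)).
  case=> same2 _ out2 out2'; split=> // u w.
  rewrite mem_rcons inE => /predU1P[->|/out2 //].
  by apply: out2'; rewrite mem_enum.
apply: foldl_ind => // l' w st2 [[nE tE] rE out2 out2'].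
rewrite bodyE //= rE; split=> //=.
- split=> // k /= k0; apply/funext=> x; apply/funext=> y.
  by rewrite (negbTE k0) /= tE.
- move=> u x ul; case: ifP => [/andP[/eqP -> /eqP ->] //|_]; exact: out2.
- move=> x; rewrite mem_rcons inE eqxx /=; case: eqVneq => [->//|_ /=]; exact: out2'.
Qed.

Hypothesis beta01 : 0 < beta < 1.

Lemma minmax_path_approx_prog_ok :
  minmax_path_approx G beta
    (num_table (run G beta minmax_path_approx_prog (init_state G)) 0).
Proof.
rewrite /minmax_path_approx_prog 4!run_seq.
set st0 := init_state G; set s := source G; set t := target G.
have [fr1 bell1] := dist_prog_ok st0; set st1 := run _ _ dist_prog _ in fr1 bell1 *.
have [fr2 bell2] := minmax_prog_ok st1; set st2 := run _ _ minmax_prog _ in fr2 bell2 *.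
set succ := node_table st1 0 in bell1; set nxt := node_table st2 1 in bell2.
have subT : subrel (edge G) (edge G) by [].
have distE : dval 1 st1 =1 dist G.
  apply: (dist_eq tg (succ := succ)); first by have [] := bellman_target tg subT bell1.
  by move=> v /(exists_edge tg)[w evw]; have [] := bellman_edge bell1 evw.
have succ_edge v : v != t -> edge G v (succ v).
  by move=> /(exists_edge tg)[w evw]; have [] := bellman_edge bell1 evw.
have csucc : cheapest_successor G succ.
  apply: (cheapest_successor_dist tg succ_edge) => v /(exists_edge tg)[w evw].
  by have [_ + _] := bellman_edge bell1 evw; rewrite !distE.
have {}bell2 v : bellman (edge G) (fun v w x => Num.max (eta G beta v w) x)
    (dval 3 st2) nxt v.
  by apply: eq_bellman (bell2 v) => // w x _; rewrite distE.
have [D2t nxt_t] := bellman_target tg subT bell2.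
have nxt_edge v : v != t -> edge G v (nxt v).
  by move=> /(exists_edge tg)[w evw]; have [] := bellman_edge bell2 evw.
have [p sp lt_p] := exists_successor_path tg nxt_edge s.
have minp := bellman_minmax tg bell2 sp.
have rhoE := bellman_minmax_path tg bell2 sp.
have tP : t \in s :: p by rewrite /t; case: sp => _ <- _; apply: mem_last.
have [] := mark_prog_ok sp _ nxt_t.
- by apply: leq_trans lt_p _; apply: max_card.
- by move=> v; rewrite (proj1 fr2) // (proj1 fr1).
set st3 := run _ _ mark_prog _ => n3 t3 markP.
have [fr4 bell4] := detour_prog_ok markP; set st4 := run _ _ detour_prog _ in fr4 bell4 *.
have succ3 v : node_table st3 0 v = succ v by rewrite n3 (proj2 fr2).
have markP4 v : num_table st4 7 v v = (v \in s :: p)%:R by rewrite (proj1 fr4).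
have := output_prog_ok markP4; lazy zeta; set ct := num_table _ 0 => outE.
have {}outE v w : ct v w = if (v \in s :: p) && (w == nxt v) then 0
    else if w == succ v then if v \in s :: p then dval 5 st4 v else 0
    else 3 * max_eta G beta s p / beta.
  rewrite outE !(proj2 fr4) // succ3 n3 rhoE.
  by rewrite {2}/dval (proj1 fr4) // t3.
have detourP v : v != t -> detour_cost G (s :: p) succ v (dval 5 st4 v).
  apply: (@bellman_detour _ _ _ _ _ (node_table st4 2)) => // u.
  have -> : succ = node_table st3 0 by apply/funext=> x; rewrite succ3.
  exact: bell4.
exists p, succ; split=> //= v w evw; have v_t := edge_source_neq tg evw.
(* The first test of the output loop recognises exactly the edges of the minmax path. *)
have PE : ((v, w) \in path_edges s p) = (v \in s :: p) && (w == nxt v).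
  apply/idP/andP => [vw|[vp /eqP ->]]; last by rewrite (successor_path_edgesE sp).
  have [vp _] := path_edges_mem vw; split=> //.
  by case: sp => sp _ _; rewrite eq_sym; apply: (path_edges_rel sp vw).
rewrite PE outE; split.
- by move=> [->//|[-> vp]]; rewrite (negbTE vp) eqxx.
- by move=> /negbTE -> /negbTE ->.
- by move=> vp -> /negbTE ->; rewrite eqxx vp; apply: detourP.
Qed.

End ProgramCorrect.

Theorem theorem6 (R : realType) :
  polynomial_time (@minmax_path_approx R) /\
  forall (V : finType) (G : graph R V) (beta : R) (ct : V -> V -> R),
    task_graph G -> 0 < beta < 1 -> minmax_path_approx G beta ct ->
    cost_configuration G ct /\
    motivating (add_cost G ct) beta (2 * opt G beta).
Proof.
split; last exact: minmax_path_approx_motivating.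
have [q qP] := exec_polynomial minmax_path_approx_prog.
exists minmax_path_approx_prog, q => V G beta tg beta01.
have := qP R V G beta (init_state G); have := minmax_path_approx_prog_ok beta tg.
by rewrite /run; case: exec.
Qed.
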